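(* Let $A\in\mathbb{C}^{n\times n}$ with $\mathrm{ind}(A)=k>0$ and let $B\in\mathbb{C}^{n\times n}$ with $\mathrm{ind}(B)=s$. Let $E_B=B^2B^{\odot}-A$ and $Z=A^{\pi}E_BA^{\odot}(I+E_BA^{\odot})^{-1}$. If $B$ is a stable perturbation of $A$ and $\|Z\|<1$, then $$\|B^{\pi}-A^{\pi}\|\le\frac{2\|Z\|}{1-\|Z\|}.$$
   Context: $\|\cdot\|$ denotes the spectral norm, $(\cdot)^*$ the conjugate transpose and $\mathrm{rk}$ the rank. The index $\mathrm{ind}(M)$ of a square matrix $M$ is the smallest nonnegative integer $m$ with $\mathrm{rk}(M^{m+1})=\mathrm{rk}(M^m)$ (with $M^0=I$), so $\mathrm{ind}(M)>0$ exactly when $M$ is singular. For $M\in\mathbb{C}^{n\times n}$ with $\mathrm{ind}(M)=m$, $M^{\odot}$ denotes the core-EP inverse of $M$: the unique $X\in\mathbb{C}^{n\times n}$ with $XM^{m+1}=M^m$, $MX^2=X$, $(MX)^*=MX$. Put $M^{\pi}:=I-MM^{\odot}$. $B$ is a stable perturbation of $A$ (with respect to the core-EP inverse) if $I-(B^{\pi}-A^{\pi})^2$ is nonsingular. It is known that in this case $I+E_BA^{\odot}$ is nonsingular, so $Z$ is well defined. *)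

(* Defs.v *)
From mathcomp Require Import all_boot all_order all_algebra.
From mathcomp Require Import all_classical all_reals.
From mathcomp Require Export complex.

Set Implicit Arguments.
Unset Strict Implicit.
Unset Printing Implicit Defensive.

Import Order.TTheory GRing.Theory Num.Theory.

Local Open Scope ring_scope.
Local Open Scope sesquilinear_scope.

Section Index.
Variables (F : fieldType) (n : nat).
Implicit Type M : 'M[F]_n.

Lemma ind_exists M : exists m, \rank (M ^+ m.+1) == \rank (M ^+ m).
Proof.
have rk_le m : (\rank (M ^+ m.+1) <= \rank (M ^+ m))%N.
  by rewrite exprSr -mulmxE mxrankM_maxl.
suff [m _ /eqP] : exists2 m, (m <= n.+1)%N & \rank (M ^+ m.+1) = \rank (M ^+ m).
  by exists m.
apply: contrapT => noind.
have lt m : (m <= n.+1)%N -> (\rank (M ^+ m.+1) < \rank (M ^+ m))%N.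
  move=> le_mn; rewrite ltn_neqAle rk_le andbT; apply/eqP => e.
  by apply: noind; exists m.
have le m : (m <= n.+1)%N -> (\rank (M ^+ m) + m <= n)%N.
  elim: m => [_|m IH ltm]; first by rewrite addn0 rank_leq_row.
  by apply: leq_trans (IH (ltnW ltm)); rewrite addnS -addSn leq_add2r lt // ltnW.
by have := leq_trans (leq_addl _ _) (le _ (leqnn n.+1)); rewrite ltnn.
Qed.

(* M ^+ 0 is 1%:M, so ind M = 0 exactly when M is invertible. *)
Definition ind M : nat := ex_minn (ind_exists M).

Lemma ind_rank M : \rank (M ^+ (ind M).+1) = \rank (M ^+ ind M).
Proof. by rewrite /ind; case: ex_minnP => m /eqP. Qed.

End Index.

Section CoreEP.
Variables (C : numClosedFieldType) (n : nat).
Implicit Type M X Y : 'M[C]_n.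

Definition is_coreEP M X : bool :=
  [&& X *m M ^+ (ind M).+1 == M ^+ ind M,
      M *m X ^+ 2 == X
    & (M *m X)^t* == M *m X].

Let ctM m p q (X : 'M[C]_(m, p)) (Y : 'M[C]_(p, q)) :
  (X *m Y)^t* = Y^t* *m X^t*.
Proof. by rewrite trmx_mul map_mxM. Qed.

Lemma coreEP_exists M : exists X, is_coreEP M X.
Proof.
set G := M ^+ ind M.
have [r [U [W [V [UW W1 fU rG]]]]] : exists r (U : 'M[C]_(n, r)) (W : 'M[C]_(r, n))
    (V : 'M[C]_(n, r)), [/\ U *m W = G, W *m V = 1%:M, row_full U & \rank G = r].
  exists (\rank G), (col_base G), (row_base G), (pinvmx (row_base G)).
  split=> //.
  - exact: mulmx_base.
  - by rewrite mulmxVp // row_base_free.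
  - exact: col_base_full.
have GM : M *m G = G *m M by rewrite /G !mulmxE -exprS -exprSr.
pose T := W *m M *m V.
have MU : M *m U = U *m T.
  by rewrite /T !mulmxA UW -GM -UW -!mulmxA W1 mulmx1.
clearbody T.
have MG : M ^+ (ind M).+1 = U *m T *m W.
  by rewrite exprS -mulmxE -/G -UW mulmxA MU.
have uT : T \in unitmx.
  rewrite -row_free_unit /row_free eqn_leq rank_leq_row /=.
  rewrite -[X in (X <= _)%N]rG /G -ind_rank MG.
  by apply: leq_trans (mxrankM_maxl _ _) (mxrankM_maxr _ _).
pose N := U^t* *m U.
have uN : N \in unitmx.
  rewrite -row_free_unit; apply: inj_row_free => v vN.
  have fUt : row_free (U^t*) by rewrite /row_free mxrank_map mxrank_tr.
  apply/eqP; rewrite -(mulmx_free_eq0 v fUt) -(dnorm_eq0 (@dotmx C n)).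
  have := dotmxE (v *m U^t*) (v *m U^t*).
  by rewrite ctM trmxCK mulmxA -(mulmxA v) vN mul0mx mxE => /eqP.
have NH : N^t* = N by rewrite /N ctM trmxCK.
have NVH : (invmx N)^t* = invmx N.
  by rewrite trmx_inv map_invmx NH.
have LU p (Z : 'M[C]_(r, p)) : invmx N *m (U^t* *m (U *m Z)) = Z.
  by rewrite (mulmxA (U^t*)) mulmxA -/N mulVmx // mul1mx.
clearbody N.
exists (U *m invmx T *m (invmx N *m U^t*)).
have MX : M *m (U *m invmx T *m (invmx N *m U^t*)) = U *m (invmx N *m U^t*).
  by rewrite !mulmxA MU -(mulmxA U) mulmxV // mulmx1.
apply/and3P; split; apply/eqP.
- by rewrite MG -/G -!mulmxA LU (mulmxA (invmx T)) mulVmx // mul1mx.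
- by rewrite expr2 -mulmxE mulmxA MX -!mulmxA LU.
- by rewrite MX !ctM NVH trmxCK mulmxA.
Qed.

Lemma coreEP_unique M X Y : is_coreEP M X -> is_coreEP M Y -> X = Y.
Proof.
set m := ind M.
have powS (Z : 'M[C]_n) j : Z ^+ j.+1 = Z *m Z ^+ j by exact: exprS.
have powSr (Z : 'M[C]_n) j : Z ^+ j.+1 = Z ^+ j *m Z by exact: exprSr.
have aux Z : is_coreEP M Z ->
  [/\ Z *m M ^+ m.+1 = M ^+ m, M *m Z *m M ^+ m = M ^+ m, (M *m Z)^t* = M *m Z
    & Z = M ^+ m *m Z ^+ m.+1].
  case/and3P => /eqP Z1 /eqP Z2 /eqP Z3.
  have MZZ : M *m Z *m Z = Z by rewrite -mulmxA -{3}Z2 powS expr1.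
  split => //; first by rewrite -{1}Z1 mulmxA MZZ Z1.
  elim: (m) => [|j IH]; first by rewrite expr0 expr1 mul1mx.
  rewrite {1}IH (powSr M) -mulmxA; congr (_ *m _).
  by rewrite (powS Z j.+1) (powS Z j) !mulmxA MZZ.
move=> /aux [X1 X2 X3 X4] /aux [Y1 Y2 Y3 Y4].
have absorb Z V : M *m Z *m M ^+ m = M ^+ m -> V = M ^+ m *m V ^+ m.+1 ->
    M *m Z *m (M *m V) = M *m V.
  by move=> ZM ->; rewrite (mulmxA M (M ^+ m)) -powS powSr -(mulmxA (M ^+ m)) mulmxA ZM.
have MXY : M *m X = M *m Y.
  by rewrite -X3 -(absorb Y X) // ctM X3 Y3 absorb.
have XMV V : V = M ^+ m *m V ^+ m.+1 -> X *m (M *m V) = V.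
  by move=> e; rewrite {1}e !mulmxA -(mulmxA X M) -powS X1 -e.
by rewrite -(XMV X X4) MXY XMV.
Qed.

Definition coreEP M : 'M[C]_n := xchoose (coreEP_exists M).

Lemma coreEPP M : is_coreEP M (coreEP M).
Proof. exact: xchooseP. Qed.

Definition coreEP_pi M : 'M[C]_n := 1%:M - M *m coreEP M.

Definition stable_perturbation (A B : 'M[C]_n) : bool :=
  1%:M - (coreEP_pi B - coreEP_pi A) ^+ 2 \in unitmx.

Definition core_pert (A B : 'M[C]_n) : 'M[C]_n := B ^+ 2 *m coreEP B - A.

Definition Zmx (A B : 'M[C]_n) : 'M[C]_n :=
  coreEP_pi A *m core_pert A B *m coreEP A *m invmx (1%:M + core_pert A B *m coreEP A).

End CoreEP.

Section SpectralNorm.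
Variable R : realType.

Definition l2norm n (x : 'cV[R[i]]_n) : R :=
  Num.sqrt (\sum_i Normc.normc (x i 0) ^+ 2).

Local Open Scope classical_set_scope.

Definition specnorm m n (M : 'M[R[i]]_(m, n)) : R :=
  sup [set l2norm (M *m x) | x in [set x | l2norm x <= 1]].

(* The set is nonempty and bounded above, so [sup] is a genuine supremum. *)
Lemma specnorm_has_sup m n (M : 'M[R[i]]_(m, n)) :
  has_sup [set l2norm (M *m x) | x in [set x | l2norm x <= 1]].
Proof.
split.
  exists (l2norm (M *m 0)), 0 => //=.
  rewrite /l2norm big1 ?sqrtr0 ?ler01 // => i _.
  by rewrite mxE Normc.normc0 expr0n.
have normc_sum (F : 'I_n -> R[i]) :
    Normc.normc (\sum_j F j) <= \sum_j Normc.normc (F j).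
  elim/big_ind2: _ => [|x a y b xa yb|//]; first by rewrite Normc.normc0.
  by apply: le_trans (le_normcD _ _) _; exact: lerD.
have normc_ge0 (z : R[i]) : 0 <= Normc.normc z.
  by case: z => a b; exact: sqrtr_ge0.
exists (Num.sqrt (\sum_i (\sum_j Normc.normc (M i j)) ^+ 2)) => _ [x /= x1 <-].
rewrite /l2norm; apply: ler_wsqrtr; apply: ler_sum => i _.
rewrite lerXn2r ?nnegrE ?sumr_ge0 // mxE.
apply: le_trans (normc_sum _) _; apply: ler_sum => j _.
rewrite Normc.normcM; apply: ler_piMr => //.
apply: le_trans x1; rewrite -[X in X <= _](ger0_norm (normc_ge0 _)) -sqrtr_sqr.
rewrite ler_wsqrtr // (bigD1 j) //= lerDl sumr_ge0 // => l _.
by rewrite exprn_ge0.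
Qed.

End SpectralNorm.

(* Main.v *)
Require Import Defs.
From mathcomp Require Import all_boot all_order all_algebra all_reals.
Import Order.TTheory GRing.Theory Num.Theory.
Local Open Scope ring_scope.
Local Open Scope sesquilinear_scope.
Local Open Scope complex_scope.

(** Write X for the core-EP inverse of A, Y for that of B, P = AX and Q = BY.
These are the orthogonal projectors onto the ranges of high powers of A and
of B, and the norm to bound is that of P - Q.

Stability says that P - Q has neither 1 nor -1 as an eigenvalue, hence that
range Q meets ker P trivially and range P meets ker Q trivially
([range_ker_trivial]). Both facts, with the injectivity of B on range Q,
make W = I + E_B X = (I - P) + BQX invertible ([pert_unit]). Now WP = BQX has
its range inside range Q, and W fixes every vector of ker P; so
Pi = W P W^-1 is the oblique projector onto range Q along ker P, and
Z = (I - P) Pi = Pi - P ([ZmxE]). In other words Z is the operator whose graph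
over range P is range Q, the tangent of the angle between the two subspaces.

From Q Pi = Pi and Pi Q = Q one reads (I - Q) P = - (I - Q) Z and
(I - P) Q = Z Q. Taking the adjoint of the second identity gives
Q - P = Q (I - P) - (I - Q) P = Q Z^* + (I - Q) Z ([projB_sub_projA]). Orthogonal
projectors are contractions and Z^* has at most the norm of Z, so the norm of
P - Q is at most 2 |Z|, hence at most 2 |Z| / (1 - |Z|) when |Z| < 1. *)

Set Implicit Arguments.
Unset Strict Implicit.
Unset Printing Implicit Defensive.

(** * The projector attached to the core-EP inverse *)

Section CoreEPTheory.
Variables (C : numClosedFieldType) (n : nat) (M : 'M[C]_n).
Local Notation X := (coreEP M).

Let powS (Y : 'M[C]_n) j : Y ^+ j.+1 = Y *m Y ^+ j. Proof. exact: exprS. Qed.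
Let powSr (Y : 'M[C]_n) j : Y ^+ j.+1 = Y ^+ j *m Y. Proof. exact: exprSr. Qed.

Lemma coreEP_projl : M *m X *m X = X.
Proof. by case/and3P: (coreEPP M) => _ /eqP + _; rewrite powS expr1 mulmxA. Qed.

Lemma coreEP_proj_adj : (M *m X)^t* = M *m X.
Proof. by case/and3P: (coreEPP M) => _ _ /eqP. Qed.

(** Multiplying X = M X X repeatedly by M and X puts range X inside the range of
every power of M; at the index of M this is where X M^(m+1) = M^m applies. *)
Lemma coreEP_factor j : X = M ^+ j *m X ^+ j.+1.
Proof.
elim: j => [|j IH]; first by rewrite expr0 expr1 mul1mx.
rewrite {1}IH (powSr M) -mulmxA; congr (_ *m _).
by rewrite (powS X j.+1) (powS X j) !mulmxA coreEP_projl.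
Qed.

(** M is injective on the range of its projector: X inverts it there. *)
Lemma coreEP_left_inverse : X *m M *m (M *m X) = M *m X.
Proof.
have MX : M *m X = M ^+ (ind M).+1 *m X ^+ (ind M).+1.
  by rewrite {1}(coreEP_factor (ind M)) mulmxA -powS.
rewrite MX mulmxA -(mulmxA X M) -powS (powSr M _.+1) mulmxA.
by case/and3P: (coreEPP M) => /eqP -> _ _; rewrite -powSr.
Qed.

Lemma coreEP_outer : X *m M *m X = X.
Proof. by rewrite -{2}coreEP_projl mulmxA coreEP_left_inverse coreEP_projl. Qed.

Lemma coreEP_proj_idem : M *m X *m (M *m X) = M *m X.
Proof. by rewrite mulmxA -(mulmxA M) -(mulmxA M) coreEP_outer. Qed.

(** M maps the range of its projector into itself. *)
Lemma coreEP_proj_invariant : M *m X *m (M *m (M *m X)) = M *m (M *m X).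
Proof. by rewrite -!(mulmxA M) (mulmxA X) coreEP_left_inverse. Qed.

End CoreEPTheory.

(** * Pairs of projectors *)

Section Projections.
Variables (F : fieldType) (n : nat).
Implicit Types P Q : 'M[F]_n.

(** A vector of range Q killed by P is an eigenvector of P - Q for -1, hence
fixed by (P - Q)^2. *)
Lemma range_ker_trivial P Q p (V : 'M[F]_(n, p)) :
  1%:M - (P - Q) ^+ 2 \in unitmx -> Q *m V = V -> P *m V = 0 -> V = 0.
Proof.
move=> u QV PV; have PQV : (P - Q) *m V = - V by rewrite mulmxBl PV QV sub0r.
rewrite -[V](mulKmx u) mulmxBl mul1mx expr2 -mulmxE -mulmxA PQV mulmxN PQV.
by rewrite opprK subrr mulmx0.
Qed.

Lemma unitmx_ker0 (W : 'M[F]_n) :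
  (forall v : 'cV[F]_n, W *m v = 0 -> v = 0) -> W \in unitmx.
Proof.
move=> injW; rewrite -unitmx_tr -row_free_unit; apply: inj_row_free => v vW.
by apply: trmx_inj; rewrite trmx0; apply: injW; rewrite -[W]trmxK -trmx_mul vW trmx0.
Qed.

End Projections.

(** * The oblique projector behind Z *)

Section Perturbation.
Variables (C : numClosedFieldType) (n : nat) (A B : 'M[C]_n).
Local Notation P := (A *m coreEP A).
Local Notation Q := (B *m coreEP B).
Local Notation W := (1%:M + core_pert A B *m coreEP A).
Local Notation Z := (Zmx A B).

Lemma coreEP_pi_sub : coreEP_pi B - coreEP_pi A = P - Q.
Proof. by rewrite /coreEP_pi opprB addrC addrA subrK. Qed.

(** This form shows how W acts: it maps range P into range Q, and it is the
identity on ker P. *)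
Lemma pertE : W = 1%:M - P + B *m Q *m coreEP A.
Proof. by rewrite /core_pert mulmxBl expr2 -mulmxE -!mulmxA -addrA (addrC (- _)). Qed.

Hypothesis stAB : stable_perturbation A B.

Lemma stable_rangeB_kerA p (V : 'M[C]_(n, p)) : Q *m V = V -> P *m V = 0 -> V = 0.
Proof. by apply: range_ker_trivial; rewrite -coreEP_pi_sub. Qed.

Lemma stable_rangeA_kerB p (V : 'M[C]_(n, p)) : P *m V = V -> Q *m V = 0 -> V = 0.
Proof. by apply: range_ker_trivial; rewrite -sqrrN opprB -coreEP_pi_sub. Qed.

(** If W v = 0 then (I - P) v = - B Q X v lies in ker P and in range Q, so both
sides vanish. As B is injective on range Q, X v lies in ker Q; it also lies in
range P, so X v = 0. Hence P v = A X v = 0 as well, and v = 0. *)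
Lemma pert_unit : W \in unitmx.
Proof.
have PP := coreEP_proj_idem A; have QBQ := coreEP_proj_invariant B.
apply: unitmx_ker0 => v; rewrite pertE mulmxDl => /eqP; rewrite addr_eq0 => /eqP e.
have v0 : (1%:M - P) *m v = 0.
  apply: stable_rangeB_kerA; last by rewrite mulmxA mulmxBr mulmx1 PP subrr mul0mx.
  by rewrite e mulmxN !mulmxA -(mulmxA (Q *m B)) -(mulmxA Q) QBQ !mulmxA.
have v1 : Q *m (coreEP A *m v) = 0.
  (* Left multiplication by the core-EP inverse of B undoes B on range Q. *)
  move: e; rewrite v0 => /eqP; rewrite eq_sym oppr_eq0 => /eqP e.
  rewrite -coreEP_left_inverse -(mulmxA (coreEP B *m B)) -(mulmxA (coreEP B)).
  by rewrite !mulmxA in e *; rewrite -!mulmxA in e *; rewrite e mulmx0.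
have v2 : coreEP A *m v = 0.
  by apply: stable_rangeA_kerB v1; rewrite mulmxA coreEP_projl.
by move: v0; rewrite mulmxBl mul1mx -mulmxA v2 mulmx0 subr0.
Qed.

(** The oblique projector onto range Q along ker P. *)
Let Pi := W *m P *m invmx W.

Lemma pert_proj : W *m P = B *m Q *m coreEP A.
Proof.
rewrite pertE mulmxDl mulmxBl mul1mx coreEP_proj_idem subrr add0r.
by rewrite -mulmxA (mulmxA (coreEP A)) coreEP_outer.
Qed.

(** I - Pi = (I - P) W^-1 because W fixes ker P pointwise; so P kills it. *)
Lemma projA_oblique : P *m Pi = P.
Proof.
have WK : W *m (1%:M - P) = 1%:M - P.
  by rewrite mulmxBr mulmx1 pert_proj pertE addrK.
have PiC : 1%:M - Pi = (1%:M - P) *m invmx W.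
  by rewrite -WK mulmxBr mulmx1 mulmxBl (mulmxV pert_unit).
rewrite -[Pi](subKr 1%:M) PiC mulmxBr mulmx1 mulmxA mulmxBr mulmx1.
by rewrite coreEP_proj_idem subrr mul0mx subr0.
Qed.

Lemma projB_oblique : Q *m Pi = Pi.
Proof. by rewrite /Pi pert_proj 2!(mulmxA Q) coreEP_proj_invariant. Qed.

Lemma ZmxE : P + Z = Pi.
Proof.
have -> : Z = (1%:M - P) *m Pi.
  rewrite /Zmx /Pi (mulmxA (1%:M - P)); congr (_ *m _).
  rewrite pert_proj /coreEP_pi /core_pert -(mulmxA (1%:M - P)) (mulmxBl (B ^+ 2 *m _)).
  rewrite mulmxBr [X in _ - X = _]mulmxBl mul1mx coreEP_proj_idem subrr subr0.
  by rewrite expr2 -mulmxE !mulmxA.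
by rewrite mulmxBl mul1mx projA_oblique addrC subrK.
Qed.

Lemma complB_projA : (1%:M - Q) *m P = - ((1%:M - Q) *m Z).
Proof.
apply/eqP; rewrite -addr_eq0 -mulmxDr ZmxE mulmxBl mul1mx.
by rewrite projB_oblique subrr.
Qed.

(** The point is Pi Q = Q: the columns of Pi Q - Q lie in range Q and, by
P Pi = P, in ker P. *)
Lemma complA_projB : (1%:M - P) *m Q = Z *m Q.
Proof.
suff PiQ : Pi *m Q = Q.
  by rewrite mulmxBl mul1mx -{1}PiQ -ZmxE mulmxDl addrAC subrr add0r.
apply/eqP; rewrite -subr_eq0; apply/eqP/stable_rangeB_kerA.
  by rewrite mulmxBr (mulmxA Q Pi) projB_oblique coreEP_proj_idem.
by rewrite mulmxBr (mulmxA P Pi) projA_oblique subrr.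
Qed.

Lemma projB_sub_projA : Q - P = Q *m Z^t* + (1%:M - Q) *m Z.
Proof.
have tM (X Y : 'M[C]_n) : (X *m Y)^t* = Y^t* *m X^t* by rewrite trmx_mul map_mxM.
have -> : Q *m Z^t* = Q *m (1%:M - P).
  rewrite -{1}(coreEP_proj_adj B) -tM -complA_projB tM coreEP_proj_adj.
  by rewrite linearB map_mxB /= trmx1 map_mx1 coreEP_proj_adj.
rewrite -[_ *m Z]opprK -complB_projA mulmxBr mulmx1 mulmxBl mul1mx.
by rewrite opprB addrA subrK.
Qed.
End Perturbation.

(** * Euclidean and spectral norms *)

Section SpectralNormTheory.
Variable R : realType.
Local Notation C := (R[i]).
Local Notation "''[' x , y ]" := (dotmx (x^T) (y^T)) : ring_scope.

Lemma dotmx_l2norm n (x : 'cV[C]_n) : '[x, x] = (l2norm x ^+ 2)%:C.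
Proof.
rewrite sqr_sqrtr; last by apply: sumr_ge0 => i _; exact: sqr_ge0.
rewrite dotmxE mxE rmorph_sum; apply: eq_bigr => i _.
by rewrite !mxE -normCK rmorphXn.
Qed.

Lemma l2norm_ge0 n (x : 'cV[C]_n) : 0 <= l2norm x.
Proof. exact: sqrtr_ge0. Qed.

Lemma sqrtC_dotmx n (x : 'cV[C]_n) : sqrtC '[x, x] = (l2norm x)%:C.
Proof. by rewrite dotmx_l2norm rmorphXn sqrCK // lecR l2norm_ge0. Qed.

Lemma l2normN n (x : 'cV[C]_n) : l2norm (- x) = l2norm x.
Proof. by congr Num.sqrt; apply: eq_bigr => i _; rewrite mxE normcN. Qed.

Lemma l2normZ n (a : R) (x : 'cV[C]_n) : l2norm (a%:C *: x) = `|a| * l2norm x.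
Proof.
rewrite -sqrtr_sqr -sqrtrM ?sqr_ge0 //; congr Num.sqrt; rewrite mulr_sumr.
apply: eq_bigr => i _; rewrite mxE Normc.normcM exprMn; congr (_ * _).
by rewrite sqr_sqrtr ?addr_ge0 ?sqr_ge0 //= expr0n addr0.
Qed.

Lemma l2norm0 n : l2norm (0 : 'cV[C]_n) = 0.
Proof. by rewrite -(scale0r 0) (l2normZ 0) normr0 mul0r. Qed.

Lemma l2norm_eq0 n (x : 'cV[C]_n) : l2norm x = 0 -> x = 0.
Proof.
move=> x0; apply: trmx_inj; rewrite trmx0; apply/eqP.
rewrite -(dnorm_eq0 (@dotmx C n)); apply/eqP.
by apply: etrans (dotmx_l2norm x) _; rewrite x0 expr0n.
Qed.

Lemma l2normD n (x y : 'cV[C]_n) : l2norm (x + y) <= l2norm x + l2norm y.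
Proof.
have [+ _] := triangle_lerif (@dotmx C n) x^T y^T.
by rewrite -linearD !sqrtC_dotmx -rmorphD lecR.
Qed.

Lemma cauchy_schwarz n (x y : 'cV[C]_n) : `|'[x, y]| <= (l2norm x * l2norm y)%:C.
Proof.
have [+ _] := CauchySchwarz_sqrt (@dotmx C n) x^T y^T.
by rewrite !sqrtC_dotmx -rmorphM.
Qed.

Lemma dotmx_adj m n (M : 'M[C]_(m, n)) x y : '[M *m x, y] = '[x, M^t* *m y].
Proof.
rewrite !dotmxE !trmxK trmx_mul map_mxM mulmxA; congr ((_ *m _ *m _) 0 0).
by apply/matrixP => i j; rewrite !mxE /= conjCK.
Qed.

(** Cauchy-Schwarz for |M^* y|^2 = (M M^* y, y). Both the bound on the norm of an
adjoint and the contractivity of orthogonal projectors follow by cancelling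
a factor. *)
Lemma l2norm_adj_sqr m n (M : 'M[C]_(m, n)) y :
  l2norm (M^t* *m y) ^+ 2 <= l2norm (M *m (M^t* *m y)) * l2norm y.
Proof.
rewrite -lecR -dotmx_l2norm -dotmx_adj.
apply: le_trans (cauchy_schwarz _ _).
by rewrite dotmx_adj dotmx_l2norm ger0_norm // lecR sqr_ge0.
Qed.

Lemma l2norm_adj_le m n (M : 'M[C]_(m, n)) c : 0 <= c ->
  (forall x, l2norm (M *m x) <= c * l2norm x) ->
  forall y, l2norm (M^t* *m y) <= c * l2norm y.
Proof.
move=> c0 Mc y; have := l2norm_adj_sqr M y; set w := M^t* *m y => lew.
have [->|w0] := eqVneq (l2norm w) 0; first by rewrite mulr_ge0 ?l2norm_ge0.
have wp : 0 < l2norm w by rewrite lt_def w0 l2norm_ge0.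
rewrite -(ler_pM2l wp) -expr2; apply: le_trans lew _.
by rewrite mulrCA mulrA ler_wpM2r ?l2norm_ge0.
Qed.

Lemma l2norm_orthoproj_le n (P : 'M[C]_n) : P^t* = P -> P *m P = P ->
  forall x, l2norm (P *m x) <= l2norm x.
Proof.
move=> PH PP x; have := l2norm_adj_sqr P x; rewrite PH mulmxA PP expr2.
have [->|x0] := eqVneq (l2norm (P *m x)) 0; first by rewrite l2norm_ge0.
by rewrite ler_pM2l // lt_def x0 l2norm_ge0.
Qed.

Lemma l2norm_le_specnorm m n (M : 'M[C]_(m, n)) x :
  l2norm (M *m x) <= specnorm M * l2norm x.
Proof.
have [x0|x0] := eqVneq (l2norm x) 0.
  by rewrite x0 (l2norm_eq0 x0) mulmx0 l2norm0 mulr0.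
have xp : 0 < l2norm x by rewrite lt_def x0 l2norm_ge0.
rewrite -ler_pdivrMr // mulrC -[_^-1]ger0_norm ?invr_ge0 ?l2norm_ge0 //.
rewrite -l2normZ scalemxAr; apply: sup_upper_bound; first exact: specnorm_has_sup.
exists ((l2norm x)^-1%:C *: x) => //=.
by rewrite l2normZ ger0_norm ?invr_ge0 ?l2norm_ge0 // mulVf.
Qed.

Lemma specnorm_ge0 m n (M : 'M[C]_(m, n)) : 0 <= specnorm M.
Proof.
apply: sup_upper_bound; first exact: specnorm_has_sup.
by exists 0; rewrite /= ?mulmx0 l2norm0 ?ler01.
Qed.

Lemma specnorm_le m n (M : 'M[C]_(m, n)) c : 0 <= c ->
  (forall x, l2norm (M *m x) <= c * l2norm x) -> specnorm M <= c.
Proof.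
move=> c0 Mc; apply: ge_sup; first by case: (specnorm_has_sup M).
by move=> _ [x /= x1 <-]; apply: le_trans (Mc x) _; exact: ler_piMr.
Qed.

End SpectralNormTheory.

(** * The perturbation bound *)

Theorem theorem3p7 (R : realType) (n k s : nat) (A B : 'M[R[i]]_n)
    (indA : ind A = k) (k_gt0 : (0 < k)%N) (indB : ind B = s)
    (stAB : stable_perturbation A B)
    (Z_lt1 : specnorm (Zmx A B) < 1) :
  specnorm (coreEP_pi B - coreEP_pi A)
    <= 2 * specnorm (Zmx A B) / (1 - specnorm (Zmx A B)).
Proof.
set Z := Zmx A B; set z := specnorm Z.
have z0 : 0 <= z by exact: specnorm_ge0.
have d0 : 0 < 1 - z by rewrite subr_gt0.
have z20 : 0 <= 2 * z by rewrite mulr_ge0 ?ler0n.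
apply: (@le_trans _ _ (2 * z)); last first.
  by rewrite ler_pdivlMr // ler_piMr // gerBl.
have Zle x : l2norm (Z *m x) <= z * l2norm x by exact: l2norm_le_specnorm.
apply: specnorm_le => // x.
have [QH QQ] := (coreEP_proj_adj B, coreEP_proj_idem B).
rewrite coreEP_pi_sub -opprB mulNmx l2normN projB_sub_projA // -/Z; clearbody Z.
move: (B *m coreEP B) QH QQ => Q QH QQ.
rewrite (mulmxDl (Q *m _)) -!mulmxA.
apply: le_trans (l2normD _ _) _.
rewrite mulr_natl mulr2n mulrDl; apply: lerD.
  exact: le_trans (l2norm_orthoproj_le QH QQ _) (l2norm_adj_le z0 Zle x).
apply: le_trans (Zle x); apply: l2norm_orthoproj_le.
  by rewrite linearB map_mxB /= trmx1 map_mx1 QH.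
by rewrite mulmxBr mulmx1 mulmxBl mul1mx QQ subrr subr0.
Qed.
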